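(* For any $p\in[1,\infty]$, there does not exist a way to define a structure of a finite-dimensional normed vector space over $\mathbb R$ on the space $E$ that agrees with the metric $\varrho_p$. Here these words mean: there does not exist a finite-dimensional topological vector space over $\mathbb R$, endowed with a metric compatible with its topology, that is isometric to the metric space $(E,\varrho_p)$.
   Context: Fix a real constant $\varkappa>0$. Let $$E^*=\{(\mathbf c,\mathbf e)\in\mathbb R^3\times\mathbb R^3 : \mathbf c\cdot\mathbf e=0,\ |\mathbf c|>0,\ |\mathbf e|<1\},$$ the set of elliptic Keplerian orbits (with marked pericenter); $\mathbf c$ is the angular momentum vector and $\mathbf e$ the Laplace vector. An element $\mathcal E=(\mathbf c,\mathbf e)\in E^*$, with $c=|\mathbf c|$ and $e=|\mathbf e|$, determines an oriented ellipse with a focus at the origin, parametrized by the eccentric anomaly $u\in\mathbb R/2\pi\mathbb Z$: $$Q(u)=a(\cos u-e)\,\mathbf P+a\sqrt{1-e^2}\,\sin u\,\mathbf S,\qquad a=\frac{c^2}{\varkappa^2(1-e^2)},\quad \mathbf S=\frac{\mathbf c}{c}\times\mathbf P,$$ where $\mathbf P=\mathbf e/e$ if $e>0$, and $\mathbf P$ is any unit vector orthogonal to $\mathbf c$ if $e=0$ (the quantity $\varrho_p$ below does not depend on this choice). For $\mathcal E_1,\mathcal E_2\in E^*$ with parametrizations $Q_1,Q_2$, put $$\varrho_p(\mathcal E_1,\mathcal E_2)=\min_{s}\left(\frac1{2\pi}\int_0^{2\pi}|Q_1(u)-Q_2(u+s)|^p\,du\right)^{1/p}\quad (1\le p<\infty),$$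 $$\varrho_\infty(\mathcal E_1,\mathcal E_2)=\min_s\max_u|Q_1(u)-Q_2(u+s)|.$$ Each $\varrho_p$ is a pseudometric on $E^*$. The space of elliptic orbits without marked pericenter is $E=E^*/\sim$, where $x\sim y$ if and only if $\varrho_p(x,y)=0$ (this relation does not depend on $p$), with the metric induced by $\varrho_p$, again denoted $\varrho_p$. *)

(* Defs.v *)
From mathcomp Require Import all_boot all_order all_algebra.
From mathcomp Require Import all_classical all_reals all_analysis.

Set Implicit Arguments.
Unset Strict Implicit.
Unset Printing Implicit Defensive.

Import Order.TTheory GRing.Theory Num.Theory.
Import numFieldNormedType.Exports.

Local Open Scope classical_set_scope.
Local Open Scope ring_scope.

Definition finite_dimensional (R : realType) (V : lmodType R) : Prop :=
  exists n, inhabited (Vector.axiom n V).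

Definition is_distance (R : realType) (T : Type) (d : T -> T -> R) : Prop :=
  [/\ forall x y, 0 <= d x y,
      forall x y, d x y = 0 <-> x = y,
      forall x y, d x y = d y x &
      forall x y z, d x z <= d x y + d y z].

(* The topology of T is the one generated by the open balls of d. *)
Definition induces_topology (R : realType) (T : topologicalType)
    (d : T -> T -> R) : Prop :=
  forall x (A : set T),
    nbhs x A <-> exists2 r, 0 < r & [set y | d x y < r] `<=` A.

Section Orbits.
Context {R : realType}.
Local Notation vec := 'rV[R]_3.

Definition dot (u v : vec) : R := \sum_i u 0 i * v 0 i.

(* The canonical norm `|u| of a row vector is the max norm. *)
Definition enorm (u : vec) : R := Num.sqrt (dot u u).

(* Indices are added modulo 3 in 'I_3. *)
Definition cross (u v : vec) : vec :=
  \row_(i < 3) (u 0 (i + 1) * v 0 (i + 2) - u 0 (i + 2) * v 0 (i + 1)).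

(* E^*: pairs (c, e) of an angular momentum and a Laplace vector. *)
Definition marked_orbits : set (vec * vec) :=
  [set x | dot x.1 x.2 = 0 /\ 0 < enorm x.1 /\ enorm x.2 < 1].

(* For a circular orbit, an arbitrary unit vector orthogonal to c. *)
Definition pericenter_dir (x : vec * vec) : vec :=
  if x.2 == 0 then xget 0 [set P | enorm P = 1 /\ dot x.1 P = 0]
  else (enorm x.2)^-1 *: x.2.

Definition semi_major_axis (kappa : R) (x : vec * vec) : R :=
  enorm x.1 ^+ 2 / (kappa ^+ 2 * (1 - enorm x.2 ^+ 2)).

(* The point with eccentric anomaly u, as a 2 * pi - periodic function on R. *)
Definition orbit_point (kappa : R) (x : vec * vec) (u : R) : vec :=
  let P := pericenter_dir x in
  let S := cross ((enorm x.1)^-1 *: x.1) P in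
  let a := semi_major_axis kappa x in
  let e := enorm x.2 in
  (a * (cos u - e)) *: P + (a * Num.sqrt (1 - e ^+ 2) * sin u) *: S.

Definition orbit_gap (kappa : R) (x y : vec * vec) (s u : R) : R :=
  enorm (orbit_point kappa x u - orbit_point kappa y (u + s)).

Definition shifted_dist (kappa : R) (p : \bar R) (x y : vec * vec) (s : R) : R :=
  match p with
  | q%:E => ((2 * pi)^-1 *
      \int[lebesgue_measure]_(u in `[0, 2 * pi]) (orbit_gap kappa x y s u `^ q))
        `^ q^-1
  | +oo%E => sup (range (orbit_gap kappa x y s))
  | -oo%E => 0
  end.

(* The infimum here and the supremum above are attained, as the functions
   involved are continuous and 2 * pi - periodic. *)
Definition rho (kappa : R) (p : \bar R) (x y : vec * vec) : R :=
  inf (range (shifted_dist kappa p x y)).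

Definition orbit_class (kappa : R) (p : \bar R) (x : vec * vec) :
    set (vec * vec) :=
  [set y | marked_orbits y /\ rho kappa p x y = 0].

(* The quotient E of E^*, as the set of equivalence classes. *)
Definition orbits (kappa : R) (p : \bar R) : set (set (vec * vec)) :=
  orbit_class kappa p @` marked_orbits.

(* As rho is a pseudometric on E^*, this does not depend on the choice of
   representatives of the classes A and B. *)
Definition rho_orbits (kappa : R) (p : \bar R) (A B : set (vec * vec)) : R :=
  rho kappa p (xget (0, 0) A) (xget (0, 0) B).

End Orbits.

(* Main.v *)
Require Import Defs.
From mathcomp Require Import all_boot all_order all_algebra.
From mathcomp Require Import all_classical all_reals all_analysis.
From mathcomp Require Import measurable_realfun.
From mathcomp Require Import ring lra.

Set Implicit Arguments.
Unset Strict Implicit.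
Unset Printing Implicit Defensive.

Import Order.TTheory GRing.Theory Num.Theory.
Import numFieldNormedType.Exports.

Local Open Scope classical_set_scope.
Local Open Scope ring_scope.

(** The obstruction is topological: the space of orbits has the homotopy type
    of a 2-sphere, while a topological vector space is contractible. Two maps
    make this concrete.

    - A unit vector [c] is sent to the circular orbit [(c, 0)]. It depends
      continuously on [c]: if [w] is a unit vector orthogonal to both [c] and
      [c'], parametrizing the two circles from [w] shows that their distance is
      at most [kappa ^- 2 * enorm (c - c')] ([rho_circle_le]).
    - An orbit with center [C] and point [cos u *: A + sin u *: B + C] at
      eccentric anomaly [u] is sent to its area vector [cross A B], a positive
      multiple of the angular momentum, hence nonzero. It does not change when
      the parameter is shifted, and it is continuous for [rho]: the
      coefficients of a trigonometric curve are its Fourier coefficients, which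
      any of the [L^p] means controls ([trig_coef_le], [area_continuous]).

    On circular orbits the area vector of the image of [c] is a positive
    multiple of [c]. If the orbits were the points of a topological vector space
    [V], these maps would become [s : S^2 -> V] and [h : V -> R^3 \ {0}], and
    [y |-> h (t *: s (y / |y|))], with [t] growing from 0 to 1 as [|y|] goes
    from 1/2 to 1, would be a continuous nowhere zero field on R^3 which points
    outwards on the boundary of the cube [[-1, 1]^3]
    ([no_sphere_in_contractible]). The Poincare-Miranda theorem excludes such a
    field ([poincare_miranda]); it is deduced by compactness from a
    Sperner lemma for cubical grids ([exists_full_cube]).

    The distance between two classes is computed on arbitrary representatives.
    A circular orbit is alone in its class ([orbit_class_circle]), so that the
    estimate of the first item applies to the classes of circular orbits. *)

(** * A Sperner lemma for cubical grids *)

Section Labels.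
Implicit Types a b c d : nat.

Definition ind (i a : nat) : int := (a == i)%:Z.

(** These are determinants of indicator vectors: [triangle_sign a b c] is the
    sign of [(a, b, c)] as a permutation of the labels 0, 1, 2, and 0 if it is
    not one; similarly for [edge_sign] with the labels 0, 1. *)
Definition edge_sign a b : int := ind 0 a * ind 1 b - ind 1 a * ind 0 b.

Definition triangle_sign a b c : int :=
  ind 2 a * edge_sign b c - ind 2 b * edge_sign a c + ind 2 c * edge_sign a b.

(** Defined as a coboundary, so that the sum over a triangulation reduces to
    the boundary; for labels at most 3 it is, up to sign, the determinant of the
    four indicator vectors. *)
Definition tetra_sign a b c d : int :=
  triangle_sign b c d - triangle_sign a c d + triangle_sign a b d
    - triangle_sign a b c.

Lemma tetra_sign_full a b c d :
  (a <= 3)%N -> (b <= 3)%N -> (c <= 3)%N -> (d <= 3)%N ->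
  tetra_sign a b c d != 0 ->
  forall l, (l <= 3)%N -> l \in [:: a; b; c; d].
Proof.
move=> ha hb hc hd h l hl; move: h.
case: a ha => [|[|[|[|//]]]] _; case: b hb => [|[|[|[|//]]]] _;
case: c hc => [|[|[|[|//]]]] _; case: d hd => [|[|[|[|//]]]] _;
by case: l hl => [|[|[|[|//]]]].
Qed.

(** With the labels 0 and 1 only, or with 0, 1 and 2 only, the signs are again
    coboundaries, which carries the computation over to lower dimension. *)
Lemma edge_sign_le1 a b : (a <= 1)%N -> (b <= 1)%N ->
  edge_sign a b = ind 1 b - ind 1 a.
Proof. by case: a => [|[|//]] _; case: b => [|[|//]] _. Qed.

Lemma triangle_sign_le2 a b c : (a <= 2)%N -> (b <= 2)%N -> (c <= 2)%N ->
  triangle_sign a b c = edge_sign b c - edge_sign a c + edge_sign a b.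
Proof.
by case: a => [|[|[|//]]] _; case: b => [|[|[|//]]] _;
  case: c => [|[|[|//]]] _.
Qed.

Lemma triangle_sign_le1 a b c : (a <= 1)%N -> (b <= 1)%N -> (c <= 1)%N ->
  triangle_sign a b c = 0.
Proof.
by case: a => [|[|//]] _; case: b => [|[|//]] _; case: c => [|[|//]] _.
Qed.

Lemma edge_sign_neq i a b : (i < 2)%N -> a != i -> b != i -> edge_sign a b = 0.
Proof.
rewrite /edge_sign /ind.
by case: i => [|[|//]] _ /negbTE -> /negbTE ->; rewrite !(mul0r, mulr0) subrr.
Qed.

Lemma triangle_sign_neq i a b c : (i < 3)%N ->
  a != i -> b != i -> c != i -> triangle_sign a b c = 0.
Proof.
rewrite /triangle_sign /edge_sign /ind.
by case: i => [|[|[|//]]] _ /negbTE -> /negbTE -> /negbTE ->;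
  rewrite !(mul0r, mulr0, subr0, addr0).
Qed.

End Labels.

Lemma telescope_nat (f : nat -> int) n :
  \sum_(i < n) (f i.+1 - f i) = f n - f 0%N.
Proof.
by rewrite -(big_mkord xpredT (fun i => f i.+1 - f i)) telescope_sumr.
Qed.

Section Grid.
Variables (n : nat) (L : nat -> nat -> nat -> nat).
Hypothesis L_le3 : forall i j k, (L i j k <= 3)%N.
Hypothesis L_low : forall i j k, (i <= n)%N -> (j <= n)%N -> (k <= n)%N ->
  [/\ i = 0%N -> L i j k = 0%N, j = 0%N -> (L i j k <= 1)%N
    & k = 0%N -> (L i j k <= 2)%N].
Hypothesis L_high : forall i j k, (i <= n)%N -> (j <= n)%N -> (k <= n)%N ->
  [/\ i = n -> L i j k != 0%N, j = n -> L i j k != 1%N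
    & k = n -> L i j k != 2%N].

(** Signed counts over the two triangles of a unit square orthogonal to the
    first, second and third axis. *)
Definition face1 i j k := triangle_sign (L i j k) (L i j.+1 k) (L i j.+1 k.+1)
  - triangle_sign (L i j k) (L i j k.+1) (L i j.+1 k.+1).
Definition face2 i j k := triangle_sign (L i j k) (L i j k.+1) (L i.+1 j k.+1)
  - triangle_sign (L i j k) (L i.+1 j k) (L i.+1 j k.+1).
Definition face3 i j k := triangle_sign (L i j k) (L i.+1 j k) (L i.+1 j.+1 k)
  - triangle_sign (L i j k) (L i j.+1 k) (L i.+1 j.+1 k).

(** The six tetrahedra of a unit cube correspond to the orders in which the
    three coordinates can be increased, with the sign of that permutation. *)
Definition cube i j k :=
  tetra_sign (L i j k) (L i.+1 j k) (L i.+1 j.+1 k) (L i.+1 j.+1 k.+1)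
  + tetra_sign (L i j k) (L i j.+1 k) (L i j.+1 k.+1) (L i.+1 j.+1 k.+1)
  + tetra_sign (L i j k) (L i j k.+1) (L i.+1 j k.+1) (L i.+1 j.+1 k.+1)
  - tetra_sign (L i j k) (L i j.+1 k) (L i.+1 j.+1 k) (L i.+1 j.+1 k.+1)
  - tetra_sign (L i j k) (L i.+1 j k) (L i.+1 j k.+1) (L i.+1 j.+1 k.+1)
  - tetra_sign (L i j k) (L i j k.+1) (L i j.+1 k.+1) (L i.+1 j.+1 k.+1).

(** The triangles inside the cube are shared by two tetrahedra of opposite
    signs and cancel. *)
Lemma cube_boundary i j k :
  cube i j k = (face1 i.+1 j k - face1 i j k) + (face2 i j.+1 k - face2 i j k)
    + (face3 i j k.+1 - face3 i j k).
Proof. rewrite /cube /face1 /face2 /face3 /tetra_sign; ring. Qed.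

(** The two-dimensional case, on the face where the label 3 is absent. The
    same telescoping leaves one side of the square, which carries the labels 0
    and 1 only and goes from a corner labelled 0 to a corner labelled 1. *)
Lemma sum_face3_bottom : (0 < n)%N ->
  \sum_(i < n) \sum_(j < n) face3 i j 0 = 1.
Proof.
move=> n0.
pose e1 i j := edge_sign (L i j 0) (L i j.+1 0).
pose e2 i j := edge_sign (L i j 0) (L i.+1 j 0).
have faceE (i j : 'I_n) :
    face3 i j 0 = (e1 i.+1 j - e1 i j) - (e2 i j.+1 - e2 i j).
  have L2 (u v : nat) : (u <= n)%N -> (v <= n)%N -> (L u v 0 <= 2)%N.
    by move=> un vn; have [_ _] := L_low un vn (leq0n n); apply.
  rewrite /face3 !triangle_sign_le2 ?L2 ?(ltnW (ltn_ord _)) //.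
  rewrite /e1 /e2; ring.
transitivity (\sum_(j < n) (e1 n j - e1 0 j)
   - \sum_(i < n) (e2 i n - e2 i 0) : int).
  under eq_bigr => i _ do under eq_bigr => j _ do rewrite faceE.
  under eq_bigr => i _ do rewrite sumrB (telescope_nat (e2 i)).
  rewrite sumrB; congr (_ - _).
  rewrite exchange_big; apply: eq_bigr => j _.
  exact: (telescope_nat (e1^~ j)).
rewrite big1 => [|j _]; last first.
  have jn := ltnW (ltn_ord j).
  have [h1 _ _] := L_high (leqnn n) jn (leq0n n).
  have [h2 _ _] := L_high (leqnn n) (ltn_ord j) (leq0n n).
  have [h3 _ _] := L_low (leq0n n) jn (leq0n n).
  have [h4 _ _] := L_low (leq0n n) (ltn_ord j) (leq0n n).
  by rewrite /e1 (@edge_sign_neq 0) ?h1 ?h2 // h3 // h4.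
have e2E (i : 'I_n) :
    e2 i n - e2 i 0 = - (ind 1 (L i.+1 0 0) - ind 1 (L i 0 0)).
  have iln := ltnW (ltn_ord i).
  have [_ h1 _] := L_high iln (leqnn n) (leq0n n).
  have [_ h2 _] := L_high (ltn_ord i) (leqnn n) (leq0n n).
  have [_ h3 _] := L_low iln (leq0n n) (leq0n n).
  have [_ h4 _] := L_low (ltn_ord i) (leq0n n) (leq0n n).
  by rewrite /e2 (@edge_sign_neq 1) ?h1 ?h2 // edge_sign_le1 ?h3 ?h4 // sub0r.
under eq_bigr => i _ do rewrite e2E.
rewrite sumrN (telescope_nat (fun i => ind 1 (L i 0 0))) sub0r opprK.
have [-> // _ _] := L_low (leq0n n) (leq0n n) (leq0n n).
have [/(_ erefl) + _ _] := L_high (leqnn n) (leq0n n) (leq0n n).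
have [_ /(_ erefl) + _] := L_low (leqnn n) (leq0n n) (leq0n n).
by case: (L n 0 0) => [|[|]].
Qed.

(** Only the faces of the whole box remain, and each of them misses one of the
    labels 0, 1, 2 except for the bottom one. *)
Lemma sum_cube : (0 < n)%N ->
  \sum_(i < n) \sum_(j < n) \sum_(k < n) cube i j k = - 1.
Proof.
move=> n0.
transitivity (\sum_(j < n) \sum_(k < n) (face1 n j k - face1 0 j k)
  + \sum_(i < n) \sum_(k < n) (face2 i n k - face2 i 0 k)
  + \sum_(i < n) \sum_(j < n) (face3 i j n - face3 i j 0) : int).
  under eq_bigr => i _ do under eq_bigr => j _ do
    under eq_bigr => k _ do rewrite cube_boundary.
  have split3 (F G H : 'I_n -> int) :
      \sum_i (F i + G i + H i) = \sum_i F i + \sum_i G i + \sum_i H i.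
    by rewrite !big_split.
  under eq_bigr => i _ do under eq_bigr => j _ do rewrite split3
    (telescope_nat (face3 i j)).
  under eq_bigr => i _ do rewrite split3.
  rewrite split3; congr (_ + _ + _).
    rewrite exchange_big; apply: eq_bigr => j _ /=.
    rewrite exchange_big; apply: eq_bigr => k _ /=.
    exact: (telescope_nat (fun i => face1 i j k)).
  apply: eq_bigr => i _; rewrite exchange_big; apply: eq_bigr => k _ /=.
  exact: (telescope_nat (fun j => face2 i j k)).
have le_ord (i : 'I_n) := ltnW (ltn_ord i).
rewrite big1 => [|j _]; last first.
  apply: big1 => k _.
  have H u v (un : (u <= n)%N) (vn : (v <= n)%N) : L n u v != 0%N.
    by have [+ _ _] := L_high (leqnn n) un vn; apply.
  have l u v (un : (u <= n)%N) (vn : (v <= n)%N) : (L 0 u v <= 1)%N.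
    by have [-> ] := L_low (leq0n n) un vn.
  rewrite /face1 !(@triangle_sign_neq 0 (L n _ _)) ?H //.
  by rewrite !triangle_sign_le1 ?l.
rewrite big1 => [|i _]; last first.
  apply: big1 => k _.
  have H u v (un : (u <= n)%N) (vn : (v <= n)%N) : L u n v != 1%N.
    by have [_ + _] := L_high un (leqnn n) vn; apply.
  have l u v (un : (u <= n)%N) (vn : (v <= n)%N) : (L u 0 v <= 1)%N.
    by have [_ -> ] := L_low un (leq0n n) vn.
  rewrite /face2 !(@triangle_sign_neq 1 (L _ n _)) ?H //.
  by rewrite !triangle_sign_le1 ?l.
rewrite !add0r -(sum_face3_bottom n0) -sumrN; apply: eq_bigr => i _.
rewrite -sumrN; apply: eq_bigr => j _.
have H u v (un : (u <= n)%N) (vn : (v <= n)%N) : L u v n != 2%N.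
  by have [_ _ +] := L_high un vn (leqnn n); apply.
by rewrite [face3 _ _ n]/face3 !(@triangle_sign_neq 2) ?H // subrr sub0r.
Qed.

(** Some cube contributes to the nonzero total, hence some tetrahedron in it
    carries all the labels. *)
Lemma exists_full_cube : (0 < n)%N ->
  exists i j k, [/\ (i < n)%N, (j < n)%N, (k < n)%N &
    forall l, (l <= 3)%N ->
    exists a b c : bool, L (i + a) (j + b) (k + c) = l].
Proof.
move=> n0.
have sum_neq0 (F : 'I_n -> int) : \sum_i F i != 0 -> exists i, F i != 0.
  move=> F0; apply/existsP; apply: contraNT F0 => /existsPn F0.
  by rewrite big1 // => i _; apply/eqP/negPn/F0.
have [|i /sum_neq0 [j /sum_neq0 [k ck]]] :=
  sum_neq0 (fun i => \sum_(j < n) \sum_(k < n) cube i j k).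
  by rewrite sum_cube.
exists i, j, k; split => // l l3.
suff /existsP[a /existsP[b /existsP[c /eqP Ll]]] :
    [exists a : bool, exists b : bool, exists c : bool,
      L (i + a) (j + b) (k + c) == l] by exists a, b, c.
apply: contraNT ck => nl.
have nL (a b c : bool) : L (i + a) (j + b) (k + c) != l.
  by apply: contraNN nl => /eqP h; apply/existsP; exists a;
    apply/existsP; exists b; apply/existsP; exists c; apply/eqP.
have := (nL false false false, nL false false true, nL false true false,
  nL false true true, nL true false false, nL true false true,
  nL true true false, nL true true true).
rewrite !addn0 !addn1 => -[[[[[[[h0 h1] h2] h3] h4] h5] h6] h7].
have T a b c d : (a <= 3)%N -> (b <= 3)%N -> (c <= 3)%N -> (d <= 3)%N ->
   a != l -> b != l -> c != l -> d != l -> tetra_sign a b c d = 0.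
  move=> a3 b3 c3 d3 /negbTE al /negbTE bl /negbTE cl /negbTE dl.
  apply/eqP; apply: contraT => /(tetra_sign_full a3 b3 c3 d3) /(_ l l3).
  by rewrite !inE !(eq_sym l) al bl cl dl.
by rewrite /cube !T.
Qed.

End Grid.

(** * The Poincare-Miranda theorem in dimension three *)

Section PoincareMiranda.
Context {R : realType}.
Implicit Types (y : 'rV[R]_3) (f : 'rV[R]_3 -> 'rV[R]_3).

Lemma I3P (P : 'I_3 -> Prop) : P 0 -> P 1 -> P 2 -> forall i, P i.
Proof.
by move=> P0 P1 P2 [[|[|[|//]]] hi]; [move: P0|move: P1|move: P2];
  congr P; apply: val_inj.
Qed.

Definition grid_point n (i j k : nat) : 'rV[R]_3 :=
  \row_l (- 1 + 2 * (nth 0%N [:: i; j; k] l)%:R / n.+1%:R).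

(** The label is the first coordinate that is negative, and 3 if none is. *)
Definition sign_label y : nat :=
  if y 0 0 < 0 then 0%N else if y 0 1 < 0 then 1%N else
  if y 0 2 < 0 then 2%N else 3%N.

Lemma sign_label_le3 y : (sign_label y <= 3)%N.
Proof. by rewrite /sign_label; do 3 (case: ifP => // _). Qed.

Lemma sign_label3 y : sign_label y = 3%N -> forall l, 0 <= y 0 l.
Proof.
rewrite /sign_label; case: ltP => h0; first by move/eqP.
case: ltP => h1; first by move/eqP.
case: ltP => h2; first by move/eqP.
by move=> _; apply: I3P.
Qed.

Lemma sign_label_lt3 y (l : 'I_3) : sign_label y = l -> y 0 l < 0.
Proof.
rewrite /sign_label; move: l; apply: I3P;
by do 3 (case: ifPn; rewrite -?leNgt => ?) => // /eqP.
Qed.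

(** If [f] had no zero, then by compactness, for a fine enough grid, some
    coordinate of [f] would have a constant sign on each small cube. But a cube with all the labels has,
    for each coordinate, a vertex where it is negative (the vertex labelled by
    it) and a vertex where it is not (the one labelled 3). *)
Lemma poincare_miranda f : continuous f ->
  (forall y, (forall j, `|y 0 j| <= 1) -> forall i,
    (y 0 i = - 1 -> f y 0 i < 0) /\ (y 0 i = 1 -> 0 < f y 0 i)) ->
  exists y, f y = 0.
Proof.
move=> cf fbd; apply: contrapT => nz.
pose K := [set y : 'rV[R]_3 | forall i, `[- 1, 1]%classic (y ord0 i)].
have cK : compact K.
  apply: (@rV_compact R 3 (fun=> `[- 1, 1]%classic)) => i.
  exact: segment_compact.
pose close n (x y : 'rV[R]_3) := forall j, `|y 0 j - x 0 j| <= 2 / n.+1%:R.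
pose P n (x : 'rV[R]_3) := exists l, (forall y, close n x y -> f y 0 l < 0) \/
  (forall y, close n x y -> 0 < f y 0 l).
have : \forall n \near \oo, K `<=` P n.
  move/compact_near_coveringP: cK; apply => x _.
  have [l fl] : exists l, f x 0 l != 0.
    apply: contrapT => h; apply: nz; exists x; apply/rowP => l; rewrite mxE.
    by apply/eqP; apply: contrapT => /negP ?; apply: h; exists l.
  have cl : {for x, continuous (fun y => f y 0 l)}.
    apply: (@continuous_comp _ _ _ f (fun M : 'rV[R]_3 => M 0 l)).
      exact: cf.
    exact: coord_continuous.
  suff : \forall x' \near x & n \near \oo,
      (forall y, close n x' y -> f y 0 l < 0) \/
      (forall y, close n x' y -> 0 < f y 0 l).
    by apply: filterS => -[x' n] /=; exists l.
  have [e e0 He] : exists2 e : R, 0 < e &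
      (forall y, ball x e y -> f y 0 l < 0) \/
      (forall y, ball x e y -> 0 < f y 0 l).
    have [fl0|fl0] := ltP (f x 0 l) 0.
      have /nbhs_ballP[e e0 He] : \forall y \near x, f y 0 l < 0.
        exact: (cvgr_lt _ cl).
      by exists e => //; left => y; exact: He.
    have {}fl0 : 0 < f x 0 l by rewrite lt_neqAle eq_sym fl.
    have /nbhs_ballP[e e0 He] : \forall y \near x, 0 < f y 0 l.
      exact: (cvgr_gt _ cl).
    by exists e => //; right => y; exact: He.
  have inball : \forall x' \near x & n \near \oo,
      forall y, close n x' y -> ball x e y.
    exists (ball x (e / 2), [set n | 2 / n.+1%:R < e / 2]) => /=.
      split; first by apply: nbhsx_ballx; rewrite divr_gt0.
      have e4 : 0 < e / 4 by rewrite divr_gt0.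
      have := near_infty_natSinv_lt (PosNum e4); apply: filterS => n /=.
      by move: (n.+1%:R^-1) => t; lra.
    move=> [x' n] /= [[_ xx'] hn] y xy; split=> // i j.
    rewrite (splitr e); apply: ball_triangle (xx' i j) _.
    rewrite ord1 /ball /= distrC; apply: le_lt_trans hn; exact: xy.
  case: He => He; [apply: filterS inball => -[x' n] /= H; left|
    apply: filterS inball => -[x' n] /= H; right]; move=> y /H; exact: He.
move=> [n _ /(_ n (leqnn n)) HK].
have pK i j k : (i <= n.+1)%N -> (j <= n.+1)%N -> (k <= n.+1)%N ->
    K (grid_point n i j k).
  move=> hi hj hk l; rewrite /= in_itv /= mxE.
  set m := nth _ _ _; have hm : (m <= n.+1)%N.
    by rewrite /m; move: l {m}; apply: I3P.
  have : 0 <= m%:R / n.+1%:R :> R by rewrite divr_ge0.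
  have : m%:R / n.+1%:R <= 1 :> R by rewrite ler_pdivrMr // mul1r ler_nat.
  rewrite -mulrA; move: (m%:R / n.+1%:R) => t h1 h0.
  by apply/andP; split; lra.
pose L i j k := sign_label (f (grid_point n i j k)).
have pl i j k : (i <= n.+1)%N -> (j <= n.+1)%N -> (k <= n.+1)%N ->
    forall l : 'I_3,
      (nth 0%N [:: i; j; k] l = 0%N -> f (grid_point n i j k) 0 l < 0) /\
      (nth 0%N [:: i; j; k] l = n.+1 -> 0 < f (grid_point n i j k) 0 l).
  move=> hi hj hk l.
  have [|h1 h2] := @fbd (grid_point n i j k) _ l.
    by move=> u; have := pK _ _ _ hi hj hk u; rewrite /= in_itv /= ler_norml.
  split=> e.
    by apply: h1; rewrite mxE e mulr0 mul0r addr0.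
  by apply: h2; rewrite mxE e mulfK ?pnatr_eq0 //; lra.
have [|i j k hi hj hk|i j k hi hj hk||] :=
    @exists_full_cube n.+1 L.
- by move=> i j k; exact: sign_label_le3.
- have h := pl _ _ _ hi hj hk.
  split=> e; rewrite /L /sign_label.
  + by have [-> //] := h 0.
  + by have [/(_ e) -> _] := h 1; case: ifP.
  + by have [/(_ e) -> _] := h 2; case: ifP => // _; case: ifP.
- have h := pl _ _ _ hi hj hk.
  split=> e; rewrite /L /sign_label.
  + have [_ /(_ e) pos] := h 0; rewrite [_ 0 0 < 0]ltNge (ltW pos) /=.
    by case: ifP => // _; case: ifP.
  + have [_ /(_ e) pos] := h 1; rewrite [_ 0 1 < 0]ltNge (ltW pos) /=.
    by case: ifP => // _; case: ifP.
  + have [_ /(_ e) pos] := h 2; rewrite [_ 0 2 < 0]ltNge (ltW pos) /=.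
    by case: ifP => // _; case: ifP.
- by [].
move=> i [j [k [hi hj hk full]]].
have [l Hl] := HK _ (pK _ _ _ (ltnW hi) (ltnW hj) (ltnW hk)).
have corner (a b c : bool) :
    close n (grid_point n i j k) (grid_point n (i + a) (j + b) (k + c)).
  move=> u; rewrite !mxE.
  set m := nth _ [:: i; j; k] _; set m' := nth _ _ _.
  have [d ->] : exists d : bool, m' = (m + d)%N.
    by rewrite /m /m'; move: u {m m'}; apply: I3P; eexists.
  rewrite natrD -!mulrA; set t := (n.+1%:R)^-1 : R.
  have t0 : 0 < t by rewrite invr_gt0.
  by case: d => /=; rewrite ler_norml; apply/andP; split; lra.
case: Hl => Hl.
  have [//|a [b [c /sign_label3 /(_ l)]]] := full 3%N.
  by rewrite leNgt Hl.
have [|a [b [c /sign_label_lt3]]] := full l; first exact: ltnW (ltn_ord l).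
by rewrite ltNge ltW // Hl.
Qed.

End PoincareMiranda.

(** * Means over a period *)

Section MeanNorm.
Context {R : realType}.
Implicit Types (p : \bar R) (g phi : R -> R).

Local Notation mu := (@lebesgue_measure R).

Definition mean g : R := (2 * pi)^-1 * \int[mu]_(u in `[0, 2 * pi]) g u.

Let pi2_gt0 : 0 < 2 * pi :> R.
Proof. by rewrite mulr_gt0 // pi_gt0. Qed.

Let integrable_cont g : continuous g -> mu.-integrable `[0, 2 * pi] (EFin \o g).
Proof.
move=> cg; apply: continuous_compact_integrable; first exact: segment_compact.
exact: continuous_subspaceT.
Qed.

Let mean_cst (r : R) : mean (fun=> r) = r.
Proof.
rewrite /mean Rintegral_cst //= lebesgue_measure_itv /= lte_fin pi2_gt0.
by rewrite -EFinB subr0 /= mulrCA mulVf ?mulr1 // gt_eqF.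
Qed.

Let le_mean g phi : mu.-integrable `[0, 2 * pi] (EFin \o g) ->
  mu.-integrable `[0, 2 * pi] (EFin \o phi) ->
  (forall u, g u <= phi u) -> mean g <= mean phi.
Proof.
move=> ig ip h; rewrite /mean ler_pM2l ?invr_gt0 //.
by apply: le_Rintegral => // u _; exact: h.
Qed.

Lemma trig_continuous (a b c : R) :
  continuous (fun u => a * cos u + b * sin u + c).
Proof.
move=> u; apply: cvgD; last exact: cvg_cst.
by apply: cvgD; apply: cvgM;
  [exact: cvg_cst|exact: continuous_cos|exact: cvg_cst|exact: continuous_sin].
Qed.

(** The mean of a trigonometric polynomial against [cos], [sin] or 1 extracts
    its Fourier coefficients, up to the factor 2. *)
Lemma mean_trig (a b c x y z : R) :
  mean (fun u => (a * cos u + b * sin u + c) * (x * cos u + y * sin u + z))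
  = a * x / 2 + b * y / 2 + c * z.
Proof.
pose F u := a * x / 2 * (u + sin u * cos u) + b * y / 2 * (u - sin u * cos u)
  + (a * y + b * x) / 2 * (sin u * sin u) + (a * z + c * x) * sin u
  - (b * z + c * y) * cos u + c * z * u.
have dF (u : R) : is_derive u (1 : R) F
    ((a * cos u + b * sin u + c) * (x * cos u + y * sin u + z)).
  apply: is_derive_eq; rewrite /GRing.scale /=.
  have := cos2Dsin2 u; set C := cos u; set S := sin u => CS.
  (* this form makes the claim an identity of rational fractions in C and S *)
  rewrite (_ : c * z * 1 = c * z * 1
    + (a * x / 2 + b * y / 2) * (C ^+ 2 + S ^+ 2 - 1)); last first.
    by rewrite CS; ring.
  by field.
have cF : continuous F.
  move=> u; apply: differentiable_continuous; apply/derivable1_diffP.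
  exact: ex_derive.
rewrite /mean /Rintegral (@continuous_FTC2 _ _ F) //.
- have pi0 : pi != 0 :> R by rewrite gt_eqF ?pi_gt0.
  rewrite /F /= sin0 cos0 mulr_natl sin2pi cos2pi.
  rewrite -[pi *+ 2]mulr_natl.
  by move: (pi : R) pi0 => w w0; field.
- by apply: continuous_subspaceT => u; apply: cvgM; exact: trig_continuous.
- split.
  + by move=> u _; exact: ex_derive.
  + by apply: cvg_at_right_filter; exact: cF.
  + by apply: cvg_at_left_filter; exact: cF.
- by move=> u _; rewrite derive1E derive_val.
Qed.

(** The functional that is minimized over the shifts in the definition of
    [rho]. *)
Definition mean_norm p g : R :=
  match p with
  | q%:E => (mean (fun u => g u `^ q)) `^ q^-1
  | +oo%E => sup (range g)
  | -oo%E => 0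
  end.

Section Bounds.
Variables (p : \bar R) (g : R -> R) (M : R).
Hypothesis p_ge1 : (1%:E <= p)%E.
Hypothesis cg : continuous g.
Hypothesis g_ge0 : forall u, 0 <= g u.
Hypothesis g_le : forall u, g u <= M.

Let integrable_pow q : 0 <= q ->
  mu.-integrable `[0, 2 * pi] (EFin \o (fun u => g u `^ q)).
Proof.
move=> q0; apply: measurable_bounded_integrable => //.
- by rewrite /= lebesgue_measure_itv /= lte_fin pi2_gt0 -EFinB ltry.
- apply: (measurableT_comp (measurable_powR q)).
  apply: measurable_funTS; exact: continuous_measurable_fun.
- exists (M `^ q); split; first exact: num_real.
  move=> r Mr u _; rewrite /= ger0_norm ?powR_ge0 //; apply: le_trans (ltW Mr).
  by apply: ge0_ler_powR; rewrite ?nnegrE // (le_trans (g_ge0 0)).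
Qed.

Lemma mean_norm_ge0 : 0 <= mean_norm p g.
Proof.
case: p p_ge1 => [q|_|//] /=; first by rewrite powR_ge0.
apply: (le_trans (g_ge0 0)); apply: ub_le_sup; last by exists 0.
by exists M => _ [u _ <-].
Qed.

Lemma mean_norm_le : mean_norm p g <= M.
Proof.
have M0 : 0 <= M := le_trans (g_ge0 0) (g_le 0).
case: p p_ge1 => [q|_|//] /=; last first.
  by apply: ge_sup; [exists (g 0); exists 0|move=> _ [u _ <-]].
rewrite lee_fin => q1; have q0 : 0 < q by exact: lt_le_trans q1.
have -> : M = (M `^ q) `^ q^-1 by rewrite -powRrM divff ?gt_eqF // powRr1.
apply: ge0_ler_powR; rewrite ?nnegrE ?powR_ge0 ?invr_ge0 ?(ltW q0) //.
  rewrite /mean mulr_ge0 // ?invr_ge0 ?(ltW pi2_gt0) //.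
  by apply: Rintegral_ge0 => u _; exact: powR_ge0.
rewrite -[leRHS]mean_cst; apply: le_mean.
- exact/integrable_pow/ltW.
- by apply: integrable_cont => u; exact: cvg_cst.
- by move=> u; apply: ge0_ler_powR; rewrite ?nnegrE ?(ltW q0).
Qed.

(** A weak form of the comparison of [L^1] and [L^p] means, with a factor 2
    that spares the Hoelder inequality: it suffices to integrate the pointwise
    bound [l `^ (q - 1) * (t - l) <= t `^ q] for the constant [l] equal to half
    of the mean of [phi]. *)
Lemma mean_le_mean_norm phi : continuous phi -> (forall u, phi u <= g u) ->
  mean phi <= 2 * mean_norm p g.
Proof.
move=> cphi phig.
have [m0|m0] := leP (mean phi) 0.
  by apply: (le_trans m0); rewrite mulr_ge0 // mean_norm_ge0.
set m := mean phi in m0 *.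
case: p p_ge1 => [q|_|//] /=; last first.
  have s u : g u <= sup (range g).
    by apply: ub_le_sup; [exists M => _ [v _ <-]|exists u].
  apply: (@le_trans _ _ (sup (range g))).
    rewrite -[leRHS]mean_cst; apply: le_mean.
    - exact: integrable_cont.
    - by apply: integrable_cont => u; exact: cvg_cst.
    - by move=> u; exact: le_trans (phig u) (s u).
  by rewrite ler_peMl ?ler1n // (le_trans (g_ge0 0)).
rewrite lee_fin => q1; have q0 : 0 < q by exact: lt_le_trans q1.
pose l := m / 2; have l0 : 0 < l by rewrite divr_gt0.
suff H : l `^ q <= mean (fun u => g u `^ q).
  rewrite mulrC -ler_pdivrMr // -/l.
  rewrite [leLHS](_ : l = (l `^ q) `^ q^-1); last first.
    by rewrite -powRrM divff ?gt_eqF // powRr1 // ltW.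
  apply: ge0_ler_powR; rewrite ?nnegrE ?powR_ge0 ?invr_ge0 ?(ltW q0) //.
  exact: le_trans (powR_ge0 _ _) H.
have young t : 0 <= t -> l `^ (q - 1) * (t - l) <= t `^ q.
  move=> t0; have [tl|lt] := leP t l.
    apply: le_trans (powR_ge0 _ _).
    by rewrite mulr_ge0_le0 ?powR_ge0 // subr_le0.
  rewrite -(@mulr_powRB1 _ t) // mulrC.
  apply: ler_pM; rewrite ?powR_ge0 ?subr_ge0 ?(ltW lt) //.
    by rewrite lerBlDr lerDl ltW.
  by apply: ge0_ler_powR; rewrite ?nnegrE ?subr_ge0 ?(ltW l0) ?(ltW lt).
have -> : l `^ q = mean (fun u => l `^ (q - 1) * (phi u - l)).
  rewrite /mean RintegralZl //; last first.
    apply: integrable_cont => u.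
    by apply: cvgB; [exact: cphi|exact: cvg_cst].
  rewrite RintegralB //; [|exact: integrable_cont|]; last first.
    by apply: integrable_cont => u; exact: cvg_cst.
  rewrite mulrCA mulrBr -/(mean phi) -/(mean (fun=> l)) mean_cst -/m.
  have -> : m - l = l by rewrite /l; lra.
  by rewrite mulrC mulr_powRB1 // ltW.
apply: le_mean.
- apply: integrable_cont => u; apply: cvgM; first exact: cvg_cst.
  by apply: cvgB; [exact: cphi|exact: cvg_cst].
- exact/integrable_pow/ltW.
move=> u; apply: le_trans (young _ (g_ge0 u)).
by rewrite ler_wpM2l ?powR_ge0 // lerB.
Qed.

End Bounds.
End MeanNorm.

(** * Euclidean geometry of three-dimensional vectors *)

Section Vectors.
Context {R : realType}.
Local Notation vec := 'rV[R]_3.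
Implicit Types (u v w : vec).

Lemma dotE u v : dot u v = u 0 0 * v 0 0 + u 0 1 * v 0 1 + u 0 2 * v 0 2.
Proof.
rewrite /dot !big_ord_recl big_ord0 addr0 addrA.
by do !congr (_ + _ * _); congr (fun_of_matrix _ _ _); apply: val_inj.
Qed.

Lemma crossE u v : (cross u v 0 0 = u 0 1 * v 0 2 - u 0 2 * v 0 1) *
  (cross u v 0 1 = u 0 2 * v 0 0 - u 0 0 * v 0 2) *
  (cross u v 0 2 = u 0 0 * v 0 1 - u 0 1 * v 0 0).
Proof.
rewrite !mxE; do !split; congr (_ * _ - _ * _);
by congr (fun_of_matrix _ _ _); apply: val_inj.
Qed.

Lemma linE : (forall u v i, (u + v) 0 i = u 0 i + v 0 i) *
  (forall u i, (- u) 0 i = - u 0 i) *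
  (forall a u i, (a *: u) 0 i = a * u 0 i).
Proof. by do !split=> *; rewrite mxE. Qed.

Lemma vecP u v : u 0 0 = v 0 0 -> u 0 1 = v 0 1 -> u 0 2 = v 0 2 -> u = v.
Proof. by move=> h0 h1 h2; apply/rowP; apply: I3P. Qed.

Lemma dotZl a u v : dot (a *: u) v = a * dot u v.
Proof. by rewrite !dotE !mxE; ring. Qed.

Lemma dotZr a u v : dot u (a *: v) = a * dot u v.
Proof. by rewrite !dotE !mxE; ring. Qed.

Lemma dot_ge0 u : 0 <= dot u u.
Proof. by rewrite dotE !addr_ge0 // -expr2 sqr_ge0. Qed.

Lemma enorm_ge0 u : 0 <= enorm u.
Proof. exact: sqrtr_ge0. Qed.

Lemma enorm_sqr u : enorm u ^+ 2 = dot u u.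
Proof. by rewrite sqr_sqrtr // dot_ge0. Qed.

Lemma enormZ a u : enorm (a *: u) = `|a| * enorm u.
Proof.
by rewrite /enorm dotZl dotZr mulrA -expr2 sqrtrM ?sqr_ge0 // sqrtr_sqr.
Qed.

Lemma coord_le_enorm u i : `|u 0 i| <= enorm u.
Proof.
rewrite -sqrtr_sqr ler_wsqrtr // dotE.
have h := (sqr_ge0 (u 0 0), sqr_ge0 (u 0 1), sqr_ge0 (u 0 2)).
by move: i; apply: I3P; move: h => [[]]; rewrite !expr2; lra.
Qed.

Lemma enorm0 : enorm (0 : vec) = 0.
Proof. by rewrite -(scale0r 0) enormZ normr0 mul0r. Qed.

Lemma enorm_eq0 u : (enorm u == 0) = (u == 0).
Proof.
apply/eqP/eqP => [u0|->]; last exact: enorm0.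
apply/rowP => i; rewrite mxE; apply/eqP.
by rewrite -normr_le0 -u0 coord_le_enorm.
Qed.

Lemma enorm_gt0 u : (0 < enorm u) = (u != 0).
Proof. by rewrite lt_neqAle enorm_ge0 andbT eq_sym enorm_eq0. Qed.

Lemma enorm_le_coords u : enorm u <= `|u 0 0| + `|u 0 1| + `|u 0 2|.
Proof.
rewrite -[leRHS]ger0_norm ?addr_ge0 // -sqrtr_sqr ler_wsqrtr //.
rewrite dotE -!expr2 -[X in X + _ + _]real_normK ?num_real //.
rewrite -[X in _ + X + _]real_normK ?num_real //.
rewrite -[X in _ + X]real_normK ?num_real //.
have := (normr_ge0 (u 0 0), normr_ge0 (u 0 1), normr_ge0 (u 0 2)).
move: `|u 0 0| `|u 0 1| `|u 0 2| => a b c [[a0 b0] c0].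
have := (mulr_ge0 a0 b0, mulr_ge0 a0 c0, mulr_ge0 b0 c0).
by rewrite !expr2 => -[[]]; lra.
Qed.

(** From the Lagrange identity
    [enorm (cross u v) ^+ 2 + dot u v ^+ 2 = enorm u ^+ 2 * enorm v ^+ 2]. *)
Lemma enorm_cross_le u v : enorm (cross u v) <= enorm u * enorm v.
Proof.
rewrite /enorm -sqrtrM ?dot_ge0 // ler_wsqrtr //.
have := sqr_ge0 (dot u v); rewrite !dotE !crossE; lra.
Qed.

Lemma enorm_continuous : continuous (@enorm R).
Proof.
have cdot : continuous (fun u : vec => dot u u).
  have -> : (fun u : vec => dot u u) =
      (fun u => u 0 0 * u 0 0 + u 0 1 * u 0 1 + u 0 2 * u 0 2).
    by apply/funext => v; rewrite dotE.
  have cc i : continuous (fun u : vec => u 0 i * u 0 i).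
    move=> v; have c := @coord_continuous R 1 3 0 i v; exact: (cvgM c c).
  move=> v; exact: (cvgD (cvgD (cc 0 v) (cc 1 v)) (cc 2 v)).
move=> u.
apply: (@continuous_comp _ _ _ (fun u : vec => dot u u) (@Num.sqrt R)).
  exact: cdot.
exact: sqrt_continuous.
Qed.

Definition direction u : vec := (enorm u)^-1 *: u.

Lemma enorm_direction u : u != 0 -> enorm (direction u) = 1.
Proof.
move=> u0; rewrite enormZ ger0_norm ?invr_ge0 ?enorm_ge0 //.
by rewrite mulVf // enorm_eq0.
Qed.

Lemma direction_continuous u : u != 0 -> {for u, continuous direction}.
Proof.
move=> u0; have nu : enorm u != 0 by rewrite enorm_eq0.
exact: (cvgZ (cvgV nu (@enorm_continuous u)) cvg_id).
Qed.

(** Two linear equations in three unknowns have a nonzero solution. *)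
Lemma exists_unit_orthogonal u v :
  exists w, [/\ enorm w = 1, dot u w = 0 & dot v w = 0].
Proof.
pose A : 'M[R]_(3, 1 + 1) := row_mx u^T v^T.
have kA : kermx A != 0.
  rewrite kermx_eq0 /row_free.
  by rewrite neq_ltn (leq_ltn_trans (rank_leq_col A)).
have /rowV0Pn[w] := kA.
move/sub_kermxP; rewrite mul_mx_row => /eqP; rewrite row_mx_eq0.
move=> /andP[/eqP wu /eqP wv] w0.
have D z : w *m z^T = 0 -> dot z w = 0.
  move/matrixP/(_ 0 0); rewrite !mxE => h; rewrite /dot -[RHS]h.
  by apply: eq_bigr => i _; rewrite mxE mulrC.
exists (direction w); split; first exact: enorm_direction.
  by rewrite dotZr D ?mulr0.
by rewrite dotZr D ?mulr0.
Qed.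

Lemma exists_angle (a b : R) : a ^+ 2 + b ^+ 2 = 1 ->
  exists s, cos s = a /\ sin s = b.
Proof.
move=> ab.
have a1 : -1 <= a <= 1.
  rewrite -ler_norml -(@ler_pXn2r _ 2) ?nnegrE // real_normK ?num_real //.
  by rewrite expr1n -ab lerDl sqr_ge0.
have sb : Num.sqrt (1 - a ^+ 2) = `|b|.
  by rewrite -ab addrAC subrr add0r sqrtr_sqr.
have [b0|b0] := leP 0 b.
  by exists (acos a); rewrite acosK ?in_itv // sin_acos // sb ger0_norm.
exists (- acos a); rewrite cosN sinN acosK ?in_itv // sin_acos // sb.
by rewrite ltr0_norm ?opprK.
Qed.

Lemma orthonormal_frame c u v : dot c c = 1 -> dot u u = 1 -> dot c u = 0 ->
  dot c v = 0 -> v = dot u v *: u + dot (cross c u) v *: cross c u.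
Proof.
move=> cc uu cu cv.
(* an identity valid for all vectors, so that [ring] can prove it *)
have E : (dot c c * dot u u - dot c u ^+ 2) *: v =
    (dot c c * dot u v - dot c u * dot c v) *: u
    + dot (cross c u) v *: cross c u
    + (dot u u * dot c v - dot c u * dot u v) *: c.
  by apply: vecP; rewrite !linE !dotE !crossE; ring.
move: E; rewrite cc uu cu cv.
rewrite !(mul0r, mulr0, mul1r, expr0n, subr0, scale0r, addr0).
by rewrite scale1r.
Qed.

End Vectors.

(** * Spheres in a topological vector space *)

Section NoSphere.
Context {R : realType}.
Local Notation vec := 'rV[R]_3.

(** Scaling contracts the image of [s] to the origin of [V], so that [h \o s]
    extends over the unit ball to a field without zeros. The scaling factor
    vanishes on a neighborhood of the origin of R^3, which makes the extension
    locally constant there. *)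
Lemma no_sphere_in_contractible (V : topologicalLmodType R)
    (s : vec -> V) (h : V -> vec) :
  (forall y, y != 0 -> {for y, continuous s}) -> continuous h ->
  (forall v, h v != 0) ->
  ~ forall y, y != 0 -> exists2 k : R, 0 < k & h (s y) = k *: y.
Proof.
move=> s_continuous h_continuous h_neq0 hs.
pose phi (y : vec) : R := Num.max 0 (Num.min 1 (2 * enorm y - 1)).
pose F y := phi y *: s y.
have F_continuous : continuous F.
  move=> y; have [y_small|y_big] := ltP (enorm y) 2^-1.
    have F0 : \forall z \near y, F z = 0.
      have : \forall z \near y, enorm z < 2^-1.
        exact: (cvgr_lt _ (@enorm_continuous R y)).
      apply: filterS => z z_small; rewrite /F /phi.
      have -> : Num.max 0 (Num.min 1 (2 * enorm z - 1)) = 0.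
        by apply: max_l; rewrite ge_min; apply/orP; right; lra.
      by rewrite scale0r.
    rewrite /continuous_at (nbhs_singleton F0).
    exact: cvg_near_cst F0.
  have y0 : y != 0 by rewrite -enorm_gt0 (lt_le_trans _ y_big) ?invr_gt0 ?ltr0n.
  have phi_continuous : {for y, continuous phi}.
    apply: (@continuous_max R 'rV[R]_3 (cst 0)); first exact: cst_continuous.
    apply: (@continuous_min R 'rV[R]_3 (cst 1)); first exact: cst_continuous.
    exact: (cvgB (cvgM (cvg_cst _) (@enorm_continuous R y)) (cvg_cst _)).
  apply: (@continuous_comp _ _ _ (fun z => (phi z : R^o, s z))
    (fun z : R^o * V => z.1 *: z.2)); last exact: scale_continuous.
  exact: (cvg_pair phi_continuous (s_continuous y y0)).
have hF_continuous : continuous (h \o F).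
  move=> y; apply: continuous_comp; first exact: F_continuous.
  exact: h_continuous.
have [|y /eqP] := poincare_miranda hF_continuous; last by apply/negP/h_neq0.
move=> y _ i.
have E : `|y 0 i| = 1 -> exists2 k, 0 < k & h (F y) 0 i = k * y 0 i.
  move=> yi.
  have y1 : 1 <= enorm y by rewrite -yi; exact: coord_le_enorm.
  have y0 : y != 0 by rewrite -enorm_gt0 (lt_le_trans ltr01).
  have [k k0 hk] := hs y y0; exists k => //.
  have -> : F y = s y.
    rewrite /F /phi min_l; last by lra.
    by rewrite max_r ?ler01 // scale1r.
  by rewrite hk linE.
split=> yi; have [|k k0 ->] := E; rewrite yi ?normrN1 ?normr1 //.
  by rewrite mulrN1 oppr_lt0.
by rewrite mulr1.
Qed.

End NoSphere.

(** * Trigonometric curves *)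

Section TrigCurve.
Context {R : realType}.
Local Notation vec := 'rV[R]_3.
Implicit Types (A B C : vec).

Definition trig_curve A B C (u : R) : vec := cos u *: A + sin u *: B + C.

Lemma trig_curve_coord A B C u i :
  trig_curve A B C u 0 i = A 0 i * cos u + B 0 i * sin u + C 0 i.
Proof. by rewrite /trig_curve !linE; ring. Qed.

Lemma enorm_trig_curve_continuous A B C :
  continuous (fun u => enorm (trig_curve A B C u)).
Proof.
have sq i :
    continuous (fun u => trig_curve A B C u 0 i * trig_curve A B C u 0 i).
  move=> u; apply: cvgM; rewrite /= trig_curve_coord;
  under eq_fun do rewrite trig_curve_coord; exact: trig_continuous.
have sqd : continuous (fun u => dot (trig_curve A B C u) (trig_curve A B C u)).
  under eq_fun do rewrite dotE.
  by move=> u; exact: (cvgD (cvgD (sq 0 u) (sq 1 u)) (sq 2 u)).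
by move=> u; apply: (@continuous_comp _ _ _ _ (@Num.sqrt R) u (sqd u));
  exact: sqrt_continuous.
Qed.

Lemma enorm_trig_curve_bounded A B C :
  exists M, forall u, enorm (trig_curve A B C u) <= M.
Proof.
pose m i := `|A 0 i| + `|B 0 i| + `|C 0 i|.
exists (m 0 + m 1 + m 2) => u.
have mi i : `|trig_curve A B C u 0 i| <= m i.
  rewrite trig_curve_coord; apply: le_trans (ler_normD _ _) _; rewrite lerD2r.
  apply: le_trans (ler_normD _ _) _; rewrite !normrM.
  have c1 : `|cos u| <= 1 by rewrite ler_norml cos_geN1 cos_le1.
  have s1 : `|sin u| <= 1 by rewrite ler_norml sin_geN1 sin_le1.
  by rewrite lerD // ler_piMr.
by apply: le_trans (enorm_le_coords _) _; rewrite !lerD.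
Qed.

(** Each coefficient is a mean of a coordinate of the curve against a weight of
    absolute value at most 1, and a coordinate is at most the norm. *)
Lemma trig_coef_le p A B C i : (1%:E <= p)%E ->
  let r := 4 * mean_norm p (fun u => enorm (trig_curve A B C u)) in
  [/\ `|A 0 i| <= r, `|B 0 i| <= r & `|C 0 i| <= r].
Proof.
move=> p1 /=.
set g := fun u => enorm (trig_curve A B C u).
have [M gM] := enorm_trig_curve_bounded A B C.
have g0 u : 0 <= g u by exact: enorm_ge0.
have cg : continuous g by exact: enorm_trig_curve_continuous.
have d0 := mean_norm_ge0 p1 g0 gM.
set d := mean_norm p g in d0 *.
have key x y z : (forall u, `|x * cos u + y * sin u + z| <= 1) ->
    `|A 0 i * x / 2 + B 0 i * y / 2 + C 0 i * z| <= 2 * d.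
  move=> w1.
  have half x' y' z' : (forall u, `|x' * cos u + y' * sin u + z'| <= 1) ->
      A 0 i * x' / 2 + B 0 i * y' / 2 + C 0 i * z' <= 2 * d.
    move=> w1'; rewrite -mean_trig; apply: (mean_le_mean_norm p1 cg g0 gM).
      by move=> u; apply: cvgM; exact: trig_continuous.
    move=> u; rewrite -trig_curve_coord; apply: le_trans (ler_norm _) _.
    rewrite normrM; apply: le_trans (coord_le_enorm (trig_curve A B C u) i).
    by rewrite ler_piMr.
  rewrite ler_norml half // andbT.
  have := half (- x) (- y) (- z) _; rewrite lerNl.
  have -> : A 0 i * (- x) / 2 + B 0 i * (- y) / 2 + C 0 i * (- z) =
    - (A 0 i * x / 2 + B 0 i * y / 2 + C 0 i * z) by ring.
  by apply=> u; rewrite !mulNr -!opprD normrN.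
split.
- have := key 1 0 0 _.
  rewrite !mulr0 !mul0r !addr0 mulr1 normrM [`|2^-1|]gtr0_norm //.
  rewrite ler_pdivrMr //.
  rewrite (_ : 2 * d * 2 = 4 * d); last by ring.
  by apply=> u; rewrite mul0r !addr0 mul1r ler_norml cos_geN1 cos_le1.
- have := key 0 1 0 _.
  rewrite !mulr0 !mul0r addr0 add0r mulr1 normrM [`|2^-1|]gtr0_norm //.
  rewrite ler_pdivrMr //.
  rewrite (_ : 2 * d * 2 = 4 * d); last by ring.
  by apply=> u; rewrite mul0r addr0 add0r mul1r ler_norml sin_geN1 sin_le1.
- have := key 0 0 1 _.
  rewrite !mulr0 !mul0r !add0r mulr1 => h.
  apply: le_trans (_ : _ <= 2 * d) _; last by lra.
  by apply: h => u; rewrite !mul0r !add0r normr1.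
Qed.

End TrigCurve.

(** * The distance between orbits and the area vector *)

Section Orbits.
Context {R : realType}.
Variables (kappa : R) (p : \bar R).
Hypothesis p_ge1 : (1%:E <= p)%E.
Local Notation vec := 'rV[R]_3.
Implicit Types (x y : vec * vec).

Definition cos_axis x : vec := semi_major_axis kappa x *: pericenter_dir x.

Definition sin_axis x : vec :=
  (semi_major_axis kappa x * Num.sqrt (1 - enorm x.2 ^+ 2)) *:
    cross ((enorm x.1)^-1 *: x.1) (pericenter_dir x).

Definition center x : vec :=
  - (semi_major_axis kappa x * enorm x.2) *: pericenter_dir x.

(** The coefficients of the orbit when the origin of the eccentric anomaly is
    moved by [s]. *)
Definition cos_axis_shift x s := cos s *: cos_axis x + sin s *: sin_axis x.
Definition sin_axis_shift x s := cos s *: sin_axis x - sin s *: cos_axis x.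

Lemma orbit_point_shift x s u : orbit_point kappa x (u + s) =
  trig_curve (cos_axis_shift x s) (sin_axis_shift x s) (center x) u.
Proof.
rewrite /orbit_point /trig_curve /cos_axis_shift /sin_axis_shift.
rewrite /cos_axis /sin_axis /center cosD sinD.
set S := cross _ _; set a := semi_major_axis _ _.
by apply/rowP => i; rewrite !linE; ring.
Qed.

Lemma orbit_gapE x y s : orbit_gap kappa x y s =
  fun u => enorm (trig_curve (cos_axis x - cos_axis_shift y s)
    (sin_axis x - sin_axis_shift y s) (center x - center y) u).
Proof.
apply/funext => u; rewrite /orbit_gap orbit_point_shift.
have := orbit_point_shift x 0 u; rewrite addr0 => ->; congr enorm.
rewrite /trig_curve /cos_axis_shift /sin_axis_shift cos0 sin0.
by apply/rowP => i; rewrite !linE; ring.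
Qed.

Lemma shifted_distE x y s :
  shifted_dist kappa p x y s = mean_norm p (orbit_gap kappa x y s).
Proof. by rewrite /shifted_dist /mean_norm; case: p. Qed.

Lemma shifted_dist_ge0 x y s : 0 <= shifted_dist kappa p x y s.
Proof.
rewrite shifted_distE orbit_gapE.
set A := _ - _; set B := _ - _; set C := _ - _.
have [M gM] := enorm_trig_curve_bounded A B C.
by apply: (mean_norm_ge0 p_ge1) gM => u; exact: enorm_ge0.
Qed.

Lemma shifted_dist_le x y s M : (forall u, orbit_gap kappa x y s u <= M) ->
  shifted_dist kappa p x y s <= M.
Proof.
move=> gM; rewrite shifted_distE; apply: (mean_norm_le p_ge1) gM => [|u].
  by rewrite orbit_gapE; exact: enorm_trig_curve_continuous.
exact: enorm_ge0.
Qed.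

Lemma rho_ge0 x y : 0 <= rho kappa p x y.
Proof.
apply: lb_le_inf; first by exists (shifted_dist kappa p x y 0), 0.
by move=> _ [s _ <-]; exact: shifted_dist_ge0.
Qed.

Lemma rho_le_gap x y s M : (forall u, orbit_gap kappa x y s u <= M) ->
  rho kappa p x y <= M.
Proof.
move=> /shifted_dist_le; apply: le_trans; apply: ge_inf; last by exists s.
by exists 0 => _ [t _ <-]; exact: shifted_dist_ge0.
Qed.

Lemma rho_refl x : rho kappa p x x = 0.
Proof.
apply/le_anti; rewrite rho_ge0 andbT; apply: (@rho_le_gap x x 0) => u.
by rewrite /orbit_gap addr0 subrr enorm0.
Qed.

Lemma rho_lt_axes x y d : rho kappa p x y < d -> exists s, forall i,
  [/\ `|cos_axis x 0 i - cos_axis_shift y s 0 i| < 4 * d,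
      `|sin_axis x 0 i - sin_axis_shift y s 0 i| < 4 * d &
      `|center x 0 i - center y 0 i| < 4 * d].
Proof.
move=> /inf_lt [|_ [s _ <-] sd].
  by exists (shifted_dist kappa p x y 0), 0.
exists s => i; rewrite shifted_distE orbit_gapE in sd.
have [] := trig_coef_le (cos_axis x - cos_axis_shift y s)
  (sin_axis x - sin_axis_shift y s) (center x - center y) i p_ge1.
rewrite !linE -(ltr_pM2l (_ : 0 < 4)) // in sd *.
by move=> h1 h2 h3; split; apply: le_lt_trans sd.
Qed.

(** The vector area of the orbit, which is half of the integral of [cross Q Q']
    over a period of its parametrization [Q], divided by [pi]. *)
Definition area x : vec := cross (cos_axis x) (sin_axis x).

(** A shift of the parameter rotates the two axes, with determinant 1. *)
Lemma area_shift x s : cross (cos_axis_shift x s) (sin_axis_shift x s) = area x.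
Proof.
rewrite /area /cos_axis_shift /sin_axis_shift.
have cs := cos2Dsin2 s.
transitivity ((cos s ^+ 2 + sin s ^+ 2) *: cross (cos_axis x) (sin_axis x)).
  move: (cos_axis x) (sin_axis x) => A B.
  by apply: vecP; rewrite !linE !crossE !linE; ring.
by rewrite cs scale1r.
Qed.

(** The cross product is continuous, and the axes of [x] are close to those of
    [y] after a suitable shift, which does not affect the area of [y]. *)
Lemma area_continuous x e : 0 < e -> exists2 d, 0 < d & forall y,
  rho kappa p x y < d -> forall i, `|area x 0 i - area y 0 i| < e.
Proof.
move=> e0.
set A := cos_axis x; set B := sin_axis x.
pose M := enorm A + enorm B + 1.
have AM i : `|A 0 i| <= M.
  apply: le_trans (coord_le_enorm _ _) _.
  by rewrite /M -addrA lerDl addr_ge0 // enorm_ge0.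
have BM i : `|B 0 i| <= M.
  apply: le_trans (coord_le_enorm _ _) _.
  by rewrite /M addrAC lerDr addr_ge0 // enorm_ge0.
have M1 : 1 <= M by rewrite /M lerDr addr_ge0 // enorm_ge0.
have M0 : 0 < M by exact: lt_le_trans M1.
(* each of the two products in a coordinate of the cross product must move by
   less than e / 2; it moves by less than 3 * M * d *)
pose d := Num.min 1 (e / (6 * M)).
have d0 : 0 < d by rewrite lt_min ltr01 divr_gt0 // mulr_gt0.
have d1 : d <= 1 by rewrite ge_min lexx.
have de : 6 * M * d <= e.
  by rewrite mulrC -ler_pdivlMr ?mulr_gt0 // ge_min lexx orbT.
have prod a b a' b' : `|a| <= M -> `|b| <= M ->
    `|a - a'| < d -> `|b - b'| < d ->
    `|a * b - a' * b'| < e / 2.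
  move=> aM bM aa bb.
  have -> : a * b - a' * b' =
    a * (b - b') + (a - a') * b - (a - a') * (b - b') by ring.
  apply: le_lt_trans (ler_normB _ _) _.
  apply: le_lt_trans (lerD (ler_normD _ _) (lexx _)) _; rewrite !normrM.
  have := (ler_pM (normr_ge0 _) (normr_ge0 _) aM (ltW bb),
           ler_pM (normr_ge0 _) (normr_ge0 _) (ltW aa) bM,
           ler_pM (normr_ge0 _) (normr_ge0 _) (ltW aa) (ltW bb)).
  move=> [[h1 h2] h3].
  have : `|a - a'| * `|b - b'| < d * M.
    apply: le_lt_trans
      (ler_pM (normr_ge0 _) (normr_ge0 _) (lexx _) (ltW bb)) _.
    rewrite mulrC; apply: (@lt_le_trans _ _ (d * d)); first by rewrite ltr_pM2l.
    by rewrite ler_pM2l // (le_trans d1).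
  move=> h4; nra.
exists (d / 4) => [|y /rho_lt_axes [s]]; first by rewrite divr_gt0.
rewrite mulrCA divff // mulr1 -(area_shift y s) => H.
have pr i j : `|A 0 i * B 0 j -
    cos_axis_shift y s 0 i * sin_axis_shift y s 0 j| < e / 2.
  by have [hA _ _] := H i; have [_ hB _] := H j; apply: prod.
have di i j : `|(A 0 i * B 0 j - A 0 j * B 0 i) -
    (cos_axis_shift y s 0 i * sin_axis_shift y s 0 j -
     cos_axis_shift y s 0 j * sin_axis_shift y s 0 i)| < e.
  have := pr i j; have := pr j i; rewrite !ltr_norml.
  by move=> /andP[h1 h2] /andP[h3 h4]; apply/andP; split; lra.
by apply: I3P; rewrite /area !crossE; exact: di.
Qed.

End Orbits.

(** * Circular orbits *)

Section Circles.
Context {R : realType}.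
Variables (kappa : R) (p : \bar R).
Hypothesis kappa_gt0 : 0 < kappa.
Hypothesis p_ge1 : (1%:E <= p)%E.
Local Notation vec := 'rV[R]_3.
Implicit Types (x y : vec * vec) (c : vec).

Lemma pericenter_dirP x : marked_orbits x ->
  [/\ dot (pericenter_dir x) (pericenter_dir x) = 1,
      dot (direction x.1) (pericenter_dir x) = 0 &
      enorm x.2 *: pericenter_dir x = x.2].
Proof.
move=> [ce _].
suff [P1 cP eP] : [/\ enorm (pericenter_dir x) = 1,
    dot x.1 (pericenter_dir x) = 0 & enorm x.2 *: pericenter_dir x = x.2].
  by rewrite -enorm_sqr P1 expr1n dotZl cP mulr0.
rewrite /pericenter_dir; case: eqP => [e0|/eqP e0].
  have [P [P1 cP _]] := exists_unit_orthogonal x.1 x.1.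
  have [Q1 cQ] := xgetPex 0
    (ex_intro (fun P => enorm P = 1 /\ dot x.1 P = 0) P (conj P1 cP)).
  by split => //; rewrite e0 enorm0 scale0r.
split; [exact: enorm_direction|by rewrite dotZr ce mulr0|].
by rewrite scalerA divff ?scale1r // enorm_eq0.
Qed.

Lemma semi_major_axis_gt0 x : marked_orbits x -> 0 < semi_major_axis kappa x.
Proof.
move=> [_ [c0 e1]]; rewrite divr_gt0 ?exprn_gt0 // mulr_gt0 ?exprn_gt0 //.
by rewrite subr_gt0 expr_lt1 ?enorm_ge0.
Qed.

Lemma areaE x : marked_orbits x -> area kappa x =
  (semi_major_axis kappa x ^+ 2 * Num.sqrt (1 - enorm x.2 ^+ 2))
    *: direction x.1.
Proof.
move=> /pericenter_dirP [PP nP _].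
rewrite /area /cos_axis /sin_axis -/(direction x.1).
move: (pericenter_dir x) (direction x.1) (semi_major_axis kappa x) PP nP.
move=> P n a PP nP.
set b := Num.sqrt _.
transitivity ((a ^+ 2 * b) *: (dot P P *: n - dot n P *: P)).
  by apply: vecP; rewrite !dotE !(crossE, linE); ring.
by rewrite PP nP scale1r scale0r subr0.
Qed.

Lemma area_neq0 x : marked_orbits x -> area kappa x != 0.
Proof.
move=> mx; rewrite areaE // scaler_eq0 negb_or; apply/andP; split.
  have [_ [_ e1]] := mx.
  rewrite mulf_neq0 // ?expf_neq0 // gt_eqF ?semi_major_axis_gt0 //.
  by rewrite sqrtr_gt0 subr_gt0 expr_lt1 ?enorm_ge0.
have [_ [c0 _]] := mx.
by rewrite -enorm_eq0 enorm_direction ?oner_eq0 // -enorm_gt0.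
Qed.

Lemma area_eq x y : rho kappa p x y = 0 -> area kappa x = area kappa y.
Proof.
move=> xy; apply/rowP => i; apply/eqP; rewrite -subr_eq0 -normr_eq0.
apply: contraT; rewrite neq_lt normr_lt0 /= => e0.
have [d d0 /(_ y)] := area_continuous kappa p_ge1 x e0.
by rewrite xy => /(_ d0 i); rewrite ltxx.
Qed.

Lemma center_eq x y : rho kappa p x y = 0 -> center kappa x = center kappa y.
Proof.
move=> xy; apply/rowP => i; apply/eqP; rewrite -subr_eq0 -normr_eq0.
apply: contraT; rewrite neq_lt normr_lt0 /= => e0.
have [|s /(_ i) [_ _]] := @rho_lt_axes _ kappa p p_ge1 x y
    (`|center kappa x 0 i - center kappa y 0 i| / 4).
  by rewrite xy divr_gt0.
by rewrite mulrCA divff // mulr1 ltxx.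
Qed.

Lemma circle_marked c : c != 0 -> marked_orbits (c, 0).
Proof.
move=> c0; split=> /=; last by rewrite enorm0 ltr01 enorm_gt0.
by rewrite -(scale0r 0) dotZr mul0r.
Qed.

Lemma semi_major_axis_circle c :
  semi_major_axis kappa (c, 0) = (enorm c / kappa) ^+ 2.
Proof.
by rewrite /semi_major_axis /= enorm0 expr0n /= subr0 mulr1 expr_div_n.
Qed.

Lemma area_circle c : c != 0 ->
  area kappa (c, 0) = (enorm c / kappa) ^+ 4 *: direction c.
Proof.
move=> c0; rewrite areaE ?semi_major_axis_circle; last exact: circle_marked.
by rewrite /= enorm0 expr0n /= subr0 sqrtr1 mulr1 -exprM.
Qed.

(** The class determines the center, which for a circular orbit forces
    [y.2 = 0], and the area vector, which then has the direction of the angular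
    momentum and the norm [(enorm c / kappa) ^+ 4]. *)
Lemma orbit_class_circle c : c != 0 ->
  orbit_class kappa p (c, 0) = [set (c, 0)].
Proof.
move=> c0; apply/seteqP; split=> [y [my cy]|_ ->]; last first.
  by split; [exact: circle_marked|exact: rho_refl].
have [PP nP eP] := pericenter_dirP my.
have a0 := semi_major_axis_gt0 my.
have y2 : y.2 = 0.
  have : center kappa y = 0.
    by rewrite -(center_eq cy) /center /= enorm0 mulr0 oppr0 scale0r.
  rewrite /center scaleNr => /eqP; rewrite oppr_eq0 -scalerA eP.
  by rewrite scaler_eq0 gt_eqF //= => /eqP.
case: y my cy y2 {PP nP eP a0} => y1 y2 /= [_ [/= y0 _]] cy e0.
rewrite e0 in cy *; move: y0; rewrite enorm_gt0 => y0.
have := area_eq cy; rewrite !area_circle // => E.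
have n0 z : 0 <= enorm z / kappa by rewrite divr_ge0 ?enorm_ge0 // ltW.
have ecy : enorm c = enorm y1.
  have nE z : z != 0 -> enorm ((enorm z / kappa) ^+ 4 *: direction z)
      = (enorm z / kappa) ^+ 4.
    by move=> z0; rewrite enormZ enorm_direction // mulr1 ger0_norm ?exprn_ge0.
  have := congr1 enorm E; rewrite !nE // => /eqP; rewrite eqrXn2 // => /eqP.
  by apply: mulIf; rewrite invr_eq0 gt_eqF.
move: E; rewrite ecy => /scalerI; rewrite /direction ecy => E.
congr (_, _); apply/esym/(@scalerI _ _ (enorm y1)^-1).
  by rewrite invr_eq0 enorm_eq0.
by apply: E; rewrite expf_neq0 // mulf_neq0 ?enorm_eq0 // invr_eq0 gt_eqF.
Qed.

(** The chosen pericenter of a circular orbit is arbitrary; a shift of the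
    parameter moves it to any given unit vector of the plane of the orbit. *)
Lemma orbit_point_circle c w : enorm c = 1 -> enorm w = 1 -> dot c w = 0 ->
  exists s, forall u, orbit_point kappa (c, 0) (u + s) =
    kappa ^- 2 *: (cos u *: w + sin u *: cross c w).
Proof.
move=> c1 w1 cw.
have c0 : c != 0 by rewrite -enorm_eq0 c1 oner_eq0.
have [PP nP _] := pericenter_dirP (circle_marked c0).
have nc : direction c = c by rewrite /direction c1 invr1 scale1r.
rewrite /= nc in nP.
have cc : dot c c = 1 by rewrite -enorm_sqr c1 expr1n.
have ww : dot w w = 1 by rewrite -enorm_sqr w1 expr1n.
have [s sE] : exists s, forall u, cos (u + s) *: pericenter_dir (c, 0) +
    sin (u + s) *: cross c (pericenter_dir (c, 0)) =
    cos u *: w + sin u *: cross c w.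
  have wE := orthonormal_frame cc PP nP cw.
  move: (pericenter_dir (c, 0)) PP nP wE => P PP nP.
  set a := dot P w; set b := dot (cross c P) w => wE.
  have ab : a ^+ 2 + b ^+ 2 = 1.
    rewrite -ww [in RHS]wE.
    transitivity (a ^+ 2 * dot P P
        + b ^+ 2 * (dot c c * dot P P - dot c P ^+ 2)).
      by rewrite PP cc nP; ring.
    by rewrite !dotE !(linE, crossE); ring.
  have [s [sa sb]] := exists_angle ab.
  have cwE : cross c w = a *: cross c P - b *: P.
    transitivity (a *: cross c P - b *: (dot c c *: P - dot c P *: c)).
      by rewrite wE; apply: vecP; rewrite !dotE !(linE, crossE); ring.
    by rewrite cc nP scale1r scale0r subr0.
  exists s => u; rewrite cwE {1}wE cosD sinD sa sb.
  by apply/rowP => i; rewrite !linE; ring.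
exists s => u; rewrite -sE /orbit_point semi_major_axis_circle /= c1 enorm0.
rewrite invr1 scale1r expr0n /= !subr0 sqrtr1 mulr1 div1r exprVn.
by rewrite scalerDr !scalerA.
Qed.

(** Measured from a common unit normal [w] of [c] and [c'], the points of the
    two circles at anomaly [u] differ by [kappa ^- 2 * sin u] times
    [cross (c - c') w]. *)
Lemma rho_circle_le c c' : enorm c = 1 -> enorm c' = 1 ->
  rho kappa p (c, 0) (c', 0) <= kappa ^- 2 * enorm (c - c').
Proof.
move=> c1 c'1.
have [w [w1 cw c'w]] := exists_unit_orthogonal c c'.
have [s sE] := orbit_point_circle c1 w1 cw.
have [s' s'E] := orbit_point_circle c'1 w1 c'w.
apply: (@rho_le_gap _ _ _ p_ge1 _ _ (s' - s)) => u.
rewrite /orbit_gap -{1}(subrK s u) sE addrCA addrC s'E.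
have -> : kappa ^- 2 *: (cos (u - s) *: w + sin (u - s) *: cross c w) -
   kappa ^- 2 *: (cos (u - s) *: w + sin (u - s) *: cross c' w) =
   (kappa ^- 2 * sin (u - s)) *: cross (c - c') w.
  by apply: vecP; rewrite !(linE, crossE); ring.
rewrite enormZ normrM -mulrA ger0_norm ?invr_ge0 ?exprn_ge0 ?(ltW kappa_gt0) //.
rewrite ler_pM2l ?invr_gt0 ?exprn_gt0 //.
have := enorm_cross_le (c - c') w; rewrite w1 mulr1; apply: le_trans.
by rewrite ler_piMl ?enorm_ge0 // ler_norml sin_geN1 sin_le1.
Qed.

End Circles.

(** * The space of orbits is not a topological vector space *)

Theorem theorem4 (R : realType) (kappa : R) (hkappa : 0 < kappa)
    (p : \bar R) (hp : (1%:E <= p)%E) :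
  ~ exists (V : topologicalLmodType R) (d : V -> V -> R)
           (f : set ('rV[R]_3 * 'rV[R]_3) -> V),
      [/\ finite_dimensional V,
          is_distance d,
          induces_topology d,
          set_bij (orbits kappa p) [set: V] f &
          forall A B, orbits kappa p A -> orbits kappa p B ->
            d (f A) (f B) = rho_orbits kappa p A B].
Proof.
move=> [V [d [f [_ _ dtop [_ finj fsurj] diso]]]].
have rep_circle (c : 'rV[R]_3) :
    xget (0, 0) [set (c, 0 : 'rV[R]_3)] = (c, 0).
  exact: (@xgetI _ (0, 0) [set (c, 0)] (c, 0) erefl).
have orbit_rep A : orbits kappa p A -> marked_orbits (xget (0, 0) A).
  case=> x mx <-.
  have xx : orbit_class kappa p x x by split=> //; exact: rho_refl.
  by have [] := xgetI (0, 0) xx.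
(* the area vector of an orbit, as a function on V *)
pose g v := xget (set0 : set ('rV[R]_3 * 'rV[R]_3))
  [set A | orbits kappa p A /\ f A = v].
have gP v : orbits kappa p (g v) /\ f (g v) = v.
  have [A oA fA] := fsurj v I.
  exact: (xgetPex set0
    (ex_intro (fun A => orbits kappa p A /\ f A = v) A (conj oA fA))).
pose h v := area kappa (xget (0, 0) (g v)).
have h_neq0 v : h v != 0 by apply/area_neq0/orbit_rep => //; have [] := gP v.
have h_continuous : continuous h.
  move=> v; apply/cvg_ballP => e e0.
  have [r r0 hr] := area_continuous kappa hp (xget (0, 0) (g v)) e0.
  apply/dtop; exists r => // w /=.
  have [[ov fv] [ow fw]] := (gP v, gP w).
  rewrite -{1}fv -{1}fw diso // => /hr {}hr.
  by split=> // i j; rewrite ord1; exact: hr.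
(* the circular orbits, as a function on the nonzero vectors *)
pose sphere (y : 'rV[R]_3) := f (orbit_class kappa p (direction y, 0)).
have circle_orbit (y : 'rV[R]_3) : y != 0 ->
    orbits kappa p (orbit_class kappa p (direction y, 0)).
  move=> y0; exists (direction y, 0) => //; apply: circle_marked.
  by rewrite -enorm_eq0 enorm_direction ?oner_eq0.
have h_sphere y : y != 0 -> h (sphere y) = kappa ^- 4 *: direction y.
  move=> y0; have y1 := enorm_direction y0.
  have dy0 : direction y != 0 by rewrite -enorm_eq0 y1 oner_eq0.
  rewrite /h; have [og fg] := gP (sphere y).
  rewrite (finj _ _ _ _ fg) ?inE //; last exact: circle_orbit.
  rewrite orbit_class_circle // rep_circle area_circle // y1 div1r exprVn.
  by congr (_ *: _); rewrite /direction y1 invr1 scale1r.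
have sphere_continuous y : y != 0 -> {for y, continuous sphere}.
  move=> y0 A /dtop [r r0 rA].
  have kr : 0 < kappa ^+ 2 * r by rewrite mulr_gt0 ?exprn_gt0.
  have near_dir : \forall z \near y,
      enorm (direction y - direction z) < kappa ^+ 2 * r.
    have cdir :
        {for y, continuous (fun z => enorm (direction y - direction z))}.
      apply: (@continuous_comp _ _ _ (fun z => direction y - direction z)
        (@enorm R)).
        exact: (cvgB (cvg_cst _) (direction_continuous y0)).
      exact: enorm_continuous.
    by apply: (cvgr_lt _ cdir); rewrite subrr enorm0.
  have near_neq0 : \forall z \near y, 0 < enorm z.
    by apply: (cvgr_gt _ (@enorm_continuous R y)); rewrite enorm_gt0.
  suff : \forall z \near y, A (sphere z) by [].
  near=> z; apply: rA; rewrite /=.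
  have z0 : z != 0 by rewrite -enorm_gt0; near: z.
  have dir_neq0 w : w != 0 -> direction w != 0 :> 'rV[R]_3.
    by move=> w0; rewrite -enorm_eq0 enorm_direction ?oner_eq0.
  rewrite diso; [|exact: circle_orbit|exact: circle_orbit].
  rewrite /rho_orbits !orbit_class_circle ?dir_neq0 // !rep_circle.
  apply: le_lt_trans (rho_circle_le hkappa hp _ _) _.
  - exact: enorm_direction.
  - exact: enorm_direction.
  - by rewrite mulrC ltr_pdivrMr ?exprn_gt0 // mulrC; near: z.
apply: (no_sphere_in_contractible sphere_continuous h_continuous h_neq0).
move=> y y0; exists (kappa ^- 4 * (enorm y)^-1); last first.
  by rewrite h_sphere // -scalerA.
by rewrite mulr_gt0 // invr_gt0 ?exprn_gt0 // enorm_gt0.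
Unshelve. all: by end_near.
Qed.
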